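(* Let $G$ be a graph on $n$ vertices with maximum vertex degree $\Delta$, and let $\epsilon\in(0,1)$. Sample $B=(1-\epsilon)\frac{n}{\Delta}$ vertices of $G$ uniformly at random, either with replacement or without replacement, and let $G'$ be the subgraph of $G$ induced by the sampled vertices. Then, with high probability, the largest connected component of $G'$ has size at most $O\!\left(\frac{\log n}{\epsilon^2}\right)$.
   Context: ''With high probability'' means with probability tending to $1$ as $n\to\infty$ (at least $1-n^{-\zeta}$ for a constant $\zeta$). *)

(* Defs.v *)
From HB Require Import structures.
From mathcomp Require Import all_boot all_order all_algebra.
From mathcomp Require Import all_classical all_reals exp.
Set Implicit Arguments. Unset Strict Implicit. Unset Printing Implicit Defensive.
Import Order.TTheory GRing.Theory Num.Theory.
Local Open Scope ring_scope.

(* A (simple) graph on n vertices: vertex set 'I_n, adjacency e : rel 'I_n,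
   assumed symmetric and irreflexive in the theorem. *)

Definition degree (n : nat) (e : rel 'I_n) (v : 'I_n) : nat := #|[set u | e v u]|.
Definition maxdeg (n : nat) (e : rel 'I_n) : nat := (\max_(v : 'I_n) degree e v)%N.

Definition induced (n : nat) (e : rel 'I_n) (S : {set 'I_n}) : rel 'I_n :=
  fun x y => [&& x \in S, y \in S & e x y].

Definition component (n : nat) (e : rel 'I_n) (S : {set 'I_n}) (x : 'I_n)
  : {set 'I_n} := [set y in S | connect (induced e S) x y].

Definition largest_cc (n : nat) (e : rel 'I_n) (S : {set 'I_n}) : nat :=
  (\max_(x in S) #|component e S x|)%N.

Definition sample_size (R : realType) (n Delta : nat) (eps : R) : nat :=
  Num.truncn ((1 - eps) * n%:R / Delta%:R).

(* Probability of event P on the sampled vertex set, when B vertices are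
   drawn uniformly at random WITH replacement: the B draws form a uniform
   function 'I_B -> 'I_n, and the sampled set is its image. *)
Definition prob_with_repl (R : realType) (n B : nat)
  (P : {set 'I_n} -> bool) : R :=
  #|[set f : {ffun 'I_B -> 'I_n} | P [set f i | i : 'I_B]]|%:R / (n ^ B)%:R.

(* Probability of event P when B vertices are drawn uniformly at random
   WITHOUT replacement: the sampled set is a uniform B-subset of 'I_n. *)
Definition prob_without_repl (R : realType) (n B : nat)
  (P : {set 'I_n} -> bool) : R :=
  #|[set S : {set 'I_n} | (#|S| == B) && P S]|%:R / ('C(n, B))%:R.

(* Main.v *)
Require Import Defs.
From HB Require Import structures.
From mathcomp Require Import all_boot all_order all_algebra.
From mathcomp Require Import all_classical all_reals sequences exp.
From mathcomp Require Import zify ring lra.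
(* Re-imported so that finite sets take precedence over classical sets. *)
From mathcomp Require Import fintype finset.
Set Implicit Arguments. Unset Strict Implicit. Unset Printing Implicit Defensive.
Import Order.TTheory GRing.Theory Num.Theory.
Local Open Scope ring_scope.

(** Let D be the maximum degree and let the vertices be kept independently with
    probability p.  The component of v is a given connected set T exactly when T
    is kept and its outer boundary, of size b, is not; this has probability
    p^k (1 - p)^b with k = #|T|, and b <= k (D - 1) once k >= 2.  For
    p = (1 - d) / D this is at most exp(- d^2 k / 4) times the probability of the
    same event at the critical density q = 1 / D, and the latter probabilities sum
    to at most 1 over T.  Hence some component is larger than L with probability
    at most n exp(- d^2 L / 4).

    A uniform j-subset is the product measure of density j / n conditioned on an
    event of probability at least 1 / (n + 1), since j is the mode of the binomial
    law; this costs only a polynomial factor.  Drawing with replacement gives,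
    conditionally on the number j <= B of distinct draws, a uniform j-subset. *)

(** * Components and their boundaries *)

Section Boundary.
Variables (n : nat) (e : rel 'I_n).
Implicit Types (S T : {set 'I_n}) (v : 'I_n).

Definition boundary T : {set 'I_n} :=
  [set u | (u \notin T) && [exists x in T, e x u]].

Lemma disjoint_boundary T : [disjoint T & boundary T].
Proof.
by rewrite disjoint_sym disjoints_subset; apply/subsetP=> u; rewrite !inE => /andP[].
Qed.

Lemma mem_component S v : v \in S -> v \in component e S v.
Proof. by move=> vS; rewrite inE vS connect0. Qed.

Lemma component_closed S v x y :
  x \in component e S v -> y \in S -> e x y -> y \in component e S v.
Proof.
rewrite !inE => /andP[xS vx] yS xy; rewrite yS /=.
by apply: (connect_trans vx); apply: connect1; rewrite /induced xS yS.
Qed.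

(** Writing [T] as the component of [v] in some [S0] encodes that [T] is connected and contains [v].
    A walk in [S] that starts in [T] can leave it only through [boundary T]; conversely the walks in
    [S0] that join [v] to [T] stay in [T], hence in [S]. The event thus becomes a cylinder, whose
    weight is a product. *)
Lemma component_eqE S0 S v : v \in S0 -> let T := component e S0 v in
  (v \in S) && (component e S v == T) =
  (T \subset S) && [disjoint S & boundary T].
Proof.
move=> vS0 T; apply/idP/idP.
  case/andP=> vS /eqP defT; apply/andP; split.
    by rewrite -defT; apply/subsetP=> x; rewrite inE => /andP[].
  rewrite disjoints_subset; apply/subsetP=> u uS; rewrite inE.
  apply/negP; rewrite inE => /andP[uT /existsP[x /andP[xT xu]]].
  by move: uT; rewrite -defT (component_closed _ uS xu) // defT.
case/andP=> /subsetP sTS; rewrite disjoints_subset => /subsetP dSB.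
have vT : v \in T by exact: mem_component.
rewrite sTS //=; apply/eqP/setP=> y; apply/idP/idP.
  rewrite inE => /andP[_ /connectP[p pp ->]] {y}.
  have: forall x, x \in T -> path (induced e S) x p -> last x p \in T.
    elim: p {pp} => //= z p IHp x xT /andP[/and3P[_ zS xz] pp].
    apply: IHp pp; apply: contraT => zT; have := dSB _ zS.
    by rewrite in_setC in_set zT /= => /negP[]; apply/existsP; exists x; rewrite xT.
  exact.
move=> yT; rewrite inE sTS //=.
move: yT; rewrite inE => /andP[_ /connectP[p pp ->]] {y}.
have: forall x, x \in T -> path (induced e S0) x p ->
    connect (induced e S) x (last x p).
  elim: p {pp} => [|z p IHp] x xT /= => [_|/andP[/and3P[xS0 zS0 xz] pp]].
    exact: connect0.
  have zT : z \in T by exact: component_closed xz.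
  by apply: connect_trans (IHp _ zT pp); apply: connect1; rewrite /induced !sTS.
exact.
Qed.

Lemma component_has_neighbour S v x : symmetric e ->
  (1 < #|component e S v|)%N -> x \in component e S v ->
  exists2 y, y \in component e S v & e x y.
Proof.
move=> esym /card_gt1P[a [b [aT bT ab]]] xT.
have [y yT xy] : exists2 y, y \in component e S v & x != y.
  by have [xa|] := eqVneq x a; [exists b; rewrite ?xa | exists a].
have isym : symmetric (induced e S).
  by move=> c d; rewrite /induced esym; case: (c \in S); case: (d \in S).
have: connect (induced e S) x y.
  move: xT yT; rewrite !inE => /andP[_ vx] /andP[_ vy].
  by apply: connect_trans vy; rewrite (sym_connect_sym isym).
case/connectP=> [[|z p] /=]; first by move=> _ yx; rewrite yx eqxx in xy.
case/andP=> /and3P[_ zS xz] _ _; exists z => //; exact: component_closed xz.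
Qed.

(** Each vertex of a connected set with at least two vertices spends one of its edges inside the
    set, which leaves at most [(maxdeg e).-1] outward. *)
Lemma card_boundary_component S v : symmetric e ->
  let T := component e S v in
  (1 < #|T|)%N -> (#|boundary T| <= #|T| * (maxdeg e).-1)%N.
Proof.
move=> esym T T1.
pose N x := [set u | e x u] :\: T.
have sBN : boundary T \subset \bigcup_(x in T) N x.
  apply/subsetP=> u; rewrite inE => /andP[uT /existsP[x /andP[xT xu]]].
  by apply/bigcupP; exists x => //; rewrite in_setD uT in_set.
apply: (leq_trans (subset_leq_card sBN)); apply: (@leq_trans (\sum_(x in T) #|N x|)).
  elim/big_ind2: _ => [|A a B b lA lB|//]; first by rewrite cards0.
  by apply: (leq_trans (leq_card_setU _ _)); exact: leq_add.
rewrite -sum_nat_const; apply: leq_sum => x xT.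
have [y yT xy] := component_has_neighbour esym T1 xT.
have lt_deg : (#|N x| < degree e x)%N.
  apply: proper_card; apply/properP; split; first exact: subsetDl.
  by exists y; rewrite ?in_setD ?yT // in_set.
have: (degree e x <= maxdeg e)%N by exact: (leq_bigmax x).
by lia.
Qed.

End Boundary.

(** * The product measure *)

Section ProductMeasure.
Variables (R : realType) (I : finType).
Implicit Types (p : R) (A D S : {set I}).

Definition weight p S : R := \prod_i (if i \in S then p else 1 - p).

Lemma weightE p S : weight p S = p ^+ #|S| * (1 - p) ^+ #|~: S|.
Proof.
rewrite /weight (bigID (mem S)) /=; congr (_ * _).
  by under eq_bigr => i -> do []; rewrite prodr_const.
rewrite -prodr_const; apply: eq_big => [i|i /negbTE -> //].
by rewrite inE.
Qed.

Lemma weight_ge0 p S : 0 <= p <= 1 -> 0 <= weight p S.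
Proof. by move=> p01; apply: prodr_ge0 => i _; case: ifP => _; lra. Qed.

Lemma sum_weight_cylinder p A D : [disjoint A & D] ->
  \sum_(S : {set I} | (A \subset S) && [disjoint S & D]) weight p S =
  p ^+ #|A| * (1 - p) ^+ #|D|.
Proof.
move=> dAD.
(* Expanding the product over [i] chooses [F i] for [i] in [S] and [G i] otherwise; the zeros kill
   the sets that meet [D] or miss a point of [A]. *)
pose F i := if i \in D then 0 else p; pose G i := if i \in A then 0 else 1 - p.
transitivity (\prod_i (F i + G i)).
  rewrite bigA_distr big_mkcond /=; apply: eq_bigr => S _.
  case: ifPn => [/andP[/subsetP sAS dSD]|].
    apply: eq_bigr => i _; rewrite /F /G; case: ifPn => iS.
      by rewrite (disjointFr dSD).
    by rewrite ifN //; apply: contra iS; exact: sAS.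
  rewrite negb_and => /orP[/subsetPn[i iA iS]|].
    by rewrite (bigD1 i) //= (negbTE iS) /G iA mul0r.
  rewrite -setI_eq0 => /set0Pn[i /setIP[iS iD]].
  by rewrite (bigD1 i) //= iS /F iD mul0r.
rewrite -!prodr_const [in RHS]big_mkcond [X in _ = _ * X]big_mkcond -big_split /=.
apply: eq_bigr => i _; rewrite /F /G.
have [iA|iA] := boolP (i \in A); first by rewrite (disjointFr dAD) // addr0 mulr1.
by case: ifP => _; rewrite ?add0r ?mul1r //; ring.
Qed.

Lemma sum_weight p : \sum_(S : {set I}) weight p S = 1.
Proof.
rewrite -[RHS](_ : p ^+ #|@set0 I| * (1 - p) ^+ #|@set0 I| = 1).
  rewrite -sum_weight_cylinder; last by rewrite -setI_eq0 setI0.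
  by apply: eq_bigl => S; rewrite sub0set -setI_eq0 setI0 eqxx.
by rewrite !cards0 !expr0 mulr1.
Qed.

End ProductMeasure.

(** * Comparison with the critical density *)

Section Comparison.
Variable R : realType.

Lemma onemx_le_expR (d : R) : 0 <= d <= 1 -> 1 - d <= expR (- (d + d ^+ 2 / 4)).
Proof.
move=> /andP[d0 d1]; set y := d + _.
(* The linear bound on [expR] is applied at [- y / 2] and squared: the leading part of [y ^+ 2 / 4]
   then offsets the [d ^+ 2 / 4] in [y]. *)
apply: (@le_trans _ _ ((1 - y / 2) ^+ 2)).
  rewrite -subr_ge0 (_ : _ - _ = d ^+ 3 / 8 + d ^+ 4 / 64); last by rewrite /y; field.
  by rewrite addr_ge0 // divr_ge0 // exprn_ge0.
rewrite (_ : - y = - (y / 2) + - (y / 2)); last by field.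
rewrite expRD expr2.
have y2 : 0 <= 1 - y / 2 by rewrite /y; nra.
by apply: ler_pM => //; exact: expR_ge1Dx.
Qed.

(** Passing from density 1/D to (1 - d)/D, each kept vertex gains a factor 1 - d and each excluded
    one costs 1 + d/(D - 1) <= exp(d/(D - 1)). As b <= k(D - 1), the total cost is at most exp(dk),
    which cancels the first-order gain and leaves the quadratic term. *)
Lemma subcritical_weight_le (d : R) (D k b : nat) :
  0 <= d <= 1 -> (0 < D)%N -> (b <= k * D.-1)%N ->
  ((1 - d) / D%:R) ^+ k * (1 - (1 - d) / D%:R) ^+ b <=
  expR (- (d ^+ 2 / 4) * k%:R) * (D%:R^-1 ^+ k * (1 - D%:R^-1) ^+ b).
Proof.
move=> d01 D0 bk.
have D1 : 1 <= D%:R :> R by rewrite ler1n.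
have Dpos : 0 < D%:R :> R by lra.
have q0 : 0 <= D%:R^-1 :> R by rewrite invr_ge0 ltW.
have q1 : D%:R^-1 <= 1 :> R by rewrite invf_le1.
have Hk : ((1 - d) / D%:R) ^+ k <=
    expR (- (d + d ^+ 2 / 4) * k%:R) * D%:R^-1 ^+ k.
  rewrite expRM_natr -exprMn lerXn2r ?nnegrE ?mulr_ge0 ?expR_ge0 //; first lra.
  by apply: ler_wpM2r => //; exact: onemx_le_expR.
have Hb : (1 - (1 - d) / D%:R) ^+ b <= expR (d * k%:R) * (1 - D%:R^-1) ^+ b.
  (* The ratio d/(D - 1) is meaningless for D = 1, but then b = 0. *)
  have [D2|D2] := ltnP 1 D; last first.
    have -> : b = 0%N by lia.
    by rewrite !expr0 mulr1 -[leLHS]expR0 ler_expR mulr_ge0 //; lra.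
  have D2R : 0 < D%:R - 1 :> R by rewrite subr_gt0 ltr1n.
  apply: (@le_trans _ _ (expR (d / (D%:R - 1) * b%:R) * (1 - D%:R^-1) ^+ b)).
    have pq : 1 - (1 - d) / D%:R = (1 + d / (D%:R - 1)) * (1 - D%:R^-1).
      by field; rewrite !lt0r_neq0.
    rewrite expRM_natr -exprMn pq lerXn2r ?nnegrE ?mulr_ge0 ?expR_ge0 //; try lra.
      by rewrite addr_ge0 // divr_ge0 //; lra.
    by apply: ler_wpM2r; [lra | exact: expR_ge1Dx].
  rewrite ler_wpM2r ?exprn_ge0 ?subr_ge0 // ler_expR.
  rewrite mulrAC ler_pdivrMr // -mulrA ler_wpM2l //; first by lra.
  have -> : D%:R - 1 = D.-1%:R :> R by rewrite -(natrB _ D0) subn1.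
  by rewrite -natrM ler_nat.
have := ler_pM _ _ Hk Hb; rewrite mulrACA -expRD.
rewrite (_ : _ + d * _ = - (d ^+ 2 / 4) * k%:R); last by ring.
apply; apply: exprn_ge0; first by rewrite mulr_ge0 //; lra.
by rewrite subr_ge0 ler_pdivrMr // mul1r; lra.
Qed.

End Comparison.

(** * Tail bound for the product measure *)

Section Tail.
Variables (R : realType) (n : nat) (e : rel 'I_n).

Lemma largest_cc_gtP (L : R) (S : {set 'I_n}) : 0 <= L ->
  L < (largest_cc e S)%:R -> exists2 v, v \in S & L < #|component e S v|%:R.
Proof.
move=> L0; have [->|S0] := eqVneq S set0.
  by rewrite /largest_cc big_set0 => /(le_lt_trans L0); rewrite ltxx.
have [|v vS maxv] := @eq_bigmax_cond _ (mem S) (fun x => #|component e S x|).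
  by rewrite card_gt0.
by exists v; rewrite // -maxv.
Qed.

Lemma weight_component_tail (d L : R) (v : 'I_n) :
  symmetric e -> (0 < maxdeg e)%N -> 0 <= d <= 1 -> 1 <= L ->
  \sum_(S : {set 'I_n} | (v \in S) && (L < #|component e S v|%:R))
     weight ((1 - d) / (maxdeg e)%:R) S <= expR (- (d ^+ 2 / 4) * L).
Proof.
move=> esym D0 d01 L1; set p := _ / _.
pose P (S : {set 'I_n}) := (v \in S) && (L < #|component e S v|%:R).
rewrite (eq_bigl P) //.
pose q : R := (maxdeg e)%:R^-1.
have q01 : 0 <= q <= 1 by rewrite /q invr_ge0 ler0n /= invf_le1 ?ltr0n // ler1n.
apply: (@le_trans _ _ (expR (- (d ^+ 2 / 4) * L) * \sum_(S | P S) weight q S));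
  last first.
  rewrite ler_piMr ?expR_ge0 // -(sum_weight 'I_n q) [leRHS](bigID P) /= lerDl.
  by apply: sumr_ge0 => S _; exact: weight_ge0.
rewrite mulr_sumr.
rewrite (partition_big (fun S => component e S v) predT) //=.
rewrite [leRHS](partition_big (fun S => component e S v) predT) //=.
apply: ler_sum => T _.
(* Either no set in the event has component [T], and both sums are empty, or a witness [S0] allows
   [component_eqE] to be applied. *)
have [S0 /andP[/andP[vS0 LT] /eqP defT]|noS] :=
  pickP (fun S => P S && (component e S v == T)); last first.
  by rewrite !big_pred0.
rewrite -mulr_sumr.
have PE S : P S && (component e S v == T) =
    (T \subset S) && [disjoint S & boundary e T].
  rewrite -defT -component_eqE // /P -andbA; congr (_ && _).
  by case: eqP => [->|]; rewrite ?LT ?andbF.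
rewrite !(eq_bigl _ _ PE) !sum_weight_cylinder ?disjoint_boundary //.
have T1 : (1 < #|T|)%N by rewrite -defT -(ltr1n R); exact: le_lt_trans LT.
apply: le_trans (subcritical_weight_le d01 D0 _) _.
  by rewrite -defT; apply: card_boundary_component; rewrite // defT.
apply: ler_wpM2r.
  by case/andP: q01 => q0 q1; rewrite mulr_ge0 // exprn_ge0 // subr_ge0.
rewrite ler_expR !mulNr lerN2 ler_wpM2l //; first by rewrite divr_ge0 // sqr_ge0.
by rewrite -defT ltW.
Qed.

Lemma weight_largest_cc_tail (d L : R) :
  symmetric e -> (0 < maxdeg e)%N -> 0 <= d <= 1 -> 1 <= L ->
  \sum_(S : {set 'I_n} | L < (largest_cc e S)%:R)
     weight ((1 - d) / (maxdeg e)%:R) S <= n%:R * expR (- (d ^+ 2 / 4) * L).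
Proof.
move=> esym D0 d01 L1; set p := _ / _.
have p01 : 0 <= p <= 1.
  have D1 : 1 <= (maxdeg e)%:R :> R by rewrite ler1n.
  rewrite divr_ge0 /= ?ler_pdivrMr; lra.
apply: (@le_trans _ _ (\sum_(v < n) expR (- (d ^+ 2 / 4) * L))); last first.
  by rewrite sumr_const card_ord mulr_natl.
apply: le_trans; last first.
  by apply: ler_sum => v _; exact: weight_component_tail.
under [leRHS]eq_bigr do rewrite big_mkcond.
(* Union bound: every bad [S] is counted for at least one vertex [v]. *)
rewrite exchange_big big_mkcond /=; apply: ler_sum => S _.
have w0 := weight_ge0 S p01.
case: ifP => [LS|_]; last by apply: sumr_ge0 => v _; case: ifP.
have [|v vS Lv] := largest_cc_gtP _ LS; first by lra.
rewrite (bigD1 v) //= vS Lv /= lerDl.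
by apply: sumr_ge0 => u _; case: ifP.
Qed.

End Tail.

(** * From the product measure to uniform sampling *)

(** These are the binomial probabilities of density j/n, scaled by n^n. The ratio of term m + 1 to
    term m is (n - m)j / ((m + 1)(n - j)), which is at least 1 for m < j and at most 1 for m >=
    j. *)
Lemma binomial_mode (n j i : nat) : (j <= n)%N -> (i <= n)%N ->
  ('C(n, i) * (j ^ i * (n - j) ^ (n - i)) <=
   'C(n, j) * (j ^ j * (n - j) ^ (n - j)))%N.
Proof.
move=> jn.
pose t i := ('C(n, i) * (j ^ i * (n - j) ^ (n - i)))%N.
rewrite -/(t i) -/(t j).
(* [tSu] and [tSl] expose a common factor of consecutive terms, so that they are compared without
   division. *)
have tSu m : (m < n)%N ->
    (m.+1 * t m.+1 = (n - m) * j * ('C(n, m) * (j ^ m * (n - j) ^ (n - m.+1))))%N.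
  by move=> mn; rewrite /t mulnA mul_bin_left expnS; ring.
have tSl m : (m < n)%N ->
    (m.+1 * t m = m.+1 * (n - j) * ('C(n, m) * (j ^ m * (n - j) ^ (n - m.+1))))%N.
  move=> mn; rewrite /t (_ : n - m = (n - m.+1).+1)%N; last by lia.
  by rewrite expnS; ring.
have up k : (k <= j)%N -> (t (j - k) <= t j)%N.
  elim: k => [|k IHk] kj; first by rewrite subn0.
  apply: leq_trans (IHk (ltnW kj)).
  have -> : (j - k = (j - k.+1).+1)%N by lia.
  rewrite -(@leq_pmul2l (j - k.+1).+1) // tSu ?tSl; try lia.
  by rewrite leq_mul2r; apply/orP; right; rewrite mulnC leq_mul; lia.
have down k : (j + k <= n)%N -> (t (j + k) <= t j)%N.
  elim: k => [|k IHk] kj; first by rewrite addn0.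
  rewrite addnS in kj *; apply: leq_trans (IHk (ltnW kj)).
  rewrite -(@leq_pmul2l (j + k).+1) // tSu ?tSl; try lia.
  by rewrite leq_mul2r; apply/orP; right; rewrite mulnC leq_mul; lia.
move=> i_n; have [ij|ji] := leqP i j.
  by rewrite -(subKn ij); apply: up; lia.
by rewrite -(subnKC (ltnW ji)); apply: down; lia.
Qed.

(** The binomial expansion of ((n - j) + j)^n has n + 1 terms, none above the mode. *)
Lemma expnn_le_binomial_mode (n j : nat) : (j <= n)%N ->
  (n ^ n <= n.+1 * ('C(n, j) * (j ^ j * (n - j) ^ (n - j))))%N.
Proof.
move=> jn; rewrite -{1}(subnK jn) expnDn -[n.+1 in leqRHS]card_ord -sum_nat_const.
by apply: leq_sum => i _; rewrite [X in (_ * X)%N]mulnC binomial_mode // -ltnS.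
Qed.

Section Uniform.
Variables (R : realType) (n : nat).
Implicit Type P : {set 'I_n} -> bool.

(* Conditioning the product measure of density j / n on the event #|S| = j,
   whose probability is at least 1 / (n + 1). *)
Lemma prob_without_repl_le_weight P (j : nat) : (0 < n)%N -> (j <= n)%N ->
  prob_without_repl R j P <= n.+1%:R * \sum_(S | P S) weight (j%:R / n%:R) S.
Proof.
move=> n0 jn; rewrite /prob_without_repl.
have nR : 0 < n%:R :> R by rewrite ltr0n.
set p : R := j%:R / n%:R; set N := #|_|; set W := \sum_(S | _) _.
have p01 : 0 <= p <= 1 by rewrite divr_ge0 ?ler_pdivrMr // mul1r ler_nat jn.
rewrite ler_pdivrMr ?ltr0n ?bin_gt0 //.
pose m : R := (j ^ j * (n - j) ^ (n - j))%:R.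
(* At j = 0 and j = n this relies on 0^0 = 1. *)
have m0 : 0 < m by rewrite ltr0n muln_gt0 !expn_gt0; case: (j) jn => [|k] //=; lia.
(* A set of size j has weight exactly m / n^n; the sets of other sizes are dropped. *)
have Nm : N%:R * m <= (n ^ n)%:R * W.
  rewrite /W mulr_sumr [leRHS](bigID (fun S : {set 'I_n} => #|S| == j)) /=.
  rewrite -[leLHS]addr0 lerD //; last first.
    by apply: sumr_ge0 => S _; rewrite mulr_ge0 // weight_ge0.
  rewrite /N mulr_natl -sumr_const le_eqVlt; apply/orP; left; apply/eqP.
  apply: eq_big => [S|S]; first by rewrite inE andbC.
  rewrite inE => /andP[/eqP cS _].
  have cSC : #|~: S| = (n - j)%N by rewrite cardsCs finset.setCK card_ord cS.
  have -> : (n ^ n)%:R = n%:R ^+ j * n%:R ^+ (n - j) :> R.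
    by rewrite -exprD subnKC // natrX.
  rewrite weightE cSC cS /m natrM !natrX.
  have -> : 1 - p = (n - j)%:R / n%:R.
    by rewrite natrB // /p; field; rewrite lt0r_neq0.
  by rewrite mulrACA -!exprMn /p ![n%:R * _]mulrC !divfK // lt0r_neq0.
have W0 : 0 <= W.
  by apply: sumr_ge0 => S _; exact: weight_ge0.
rewrite -(ler_pM2r m0); apply: (le_trans Nm).
have -> : n.+1%:R * W * 'C(n, j)%:R * m =
    (n.+1 * ('C(n, j) * (j ^ j * (n - j) ^ (n - j))))%:R * W.
  by rewrite /m !natrM; ring.
by rewrite ler_wpM2r // ler_nat expnn_le_binomial_mode.
Qed.

(** Composing with a bijection from [S] to [S'], here the one matching their enumerations, sends
    maps with image [S] injectively to maps with image [S']. *)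
Lemma card_fibre_image (B : nat) (S S' : {set 'I_n}) : #|S| = #|S'| ->
  #|[set f : {ffun 'I_B -> 'I_n} | [set f i | i : 'I_B] == S]| =
  #|[set f : {ffun 'I_B -> 'I_n} | [set f i | i : 'I_B] == S']|.
Proof.
wlog suff le : S S' / #|S| = #|S'| ->
  (#|[set f : {ffun 'I_B -> 'I_n} | [set f i | i : 'I_B] == S]| <=
  #|[set f : {ffun 'I_B -> 'I_n} | [set f i | i : 'I_B] == S']|)%N.
  by move=> SS'; apply/eqP; rewrite eqn_leq !le.
move=> SS'; pose h x := nth x (enum S') (index x (enum S)).
have hS' x : x \in S -> h x \in S'.
  move=> xS; rewrite -mem_enum mem_nth // -cardE -SS' cardE index_mem.
  by rewrite mem_enum.
have h_inj : {in S &, injective h}.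
  move=> x y xS yS; rewrite /h (set_nth_default y); last first.
    by rewrite -cardE -SS' cardE index_mem mem_enum.
  move/eqP; rewrite nth_uniq ?enum_uniq -?cardE -?SS' ?cardE ?index_mem ?mem_enum //.
  by move/eqP/index_inj=> -> //; rewrite mem_enum.
have hS : h @: S = S'.
  apply/eqP; rewrite eqEcard card_in_imset // SS' leqnn andbT.
  by apply/subsetP=> _ /imsetP[x xS ->]; exact: hS'.
pose H (f : {ffun 'I_B -> 'I_n}) := [ffun i => h (f i)].
rewrite -(@card_in_imset _ _ H); last first.
  move=> f g; rewrite !inE => /eqP fS /eqP gS /ffunP fg; apply/ffunP=> i.
  have := fg i; rewrite !ffunE; apply: h_inj; [rewrite -fS | rewrite -gS]; exact: imset_f.
apply/subset_leq_card/subsetP=> _ /imsetP[f + ->]; rewrite !inE => /eqP fS.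
by rewrite -hS -fS -imset_comp; apply/eqP/eq_imset => i; rewrite /H ffunE.
Qed.

(* Conditionally on its size, the set of distinct draws is uniform. *)
Lemma prob_with_repl_le (B : nat) P (beta : R) : (0 < n)%N -> (B <= n)%N ->
  (forall j, (j <= B)%N -> prob_without_repl R j P <= beta) ->
  prob_with_repl R B P <= beta.
Proof.
move=> n0 Bn le_beta; rewrite /prob_with_repl.
rewrite ler_pdivrMr ?ltr0n ?expn_gt0 ?n0 //.
pose im (f : {ffun 'I_B -> 'I_n}) : {set 'I_n} := [set f i | i : 'I_B].
pose c S := #|[set f | im f == S]|.
have sum_c Q : #|[set f | Q (im f)]| = (\sum_(S | Q S) c S)%N.
  rewrite -sum1_card (partition_big im Q) => [|f]; last by rewrite inE.
  apply: eq_bigr => S QS; rewrite /c -sum1_card; apply: eq_bigl => f.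
  by rewrite !inE; case: eqP => [->|]; rewrite ?QS ?andbF.
have -> : (n ^ B)%N = (\sum_(S : {set 'I_n}) c S)%N.
  by rewrite -(sum_c xpredT) cardsT card_ffun !card_ord.
rewrite (sum_c P) !natr_sum.
(* No set has more than n elements, so [inord] loses nothing. *)
pose k (S : {set 'I_n}) : 'I_n.+1 := inord #|S|.
rewrite (partition_big k predT) //= [X in _ * X](partition_big k predT) //=.
rewrite mulr_sumr; apply: ler_sum => j _.
have kE S : (k S == j) = (#|S| == j).
  by rewrite -val_eqE /= inordK // ltnS -[leqRHS]card_ord max_card.
have [jB|jB] := leqP j B; last first.
  have c0 S : k S == j -> (c S)%:R = 0 :> R.
    rewrite kE => /eqP Sj; apply/eqP; rewrite pnatr_eq0 cards_eq0.
    apply/eqP/setP=> f; rewrite !inE; apply/negbTE/eqP=> fS.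
    have := leq_imset_card f 'I_B; rewrite -/(im f) fS Sj card_ord; lia.
  by rewrite !big1 ?mulr0 // => S /andP[_]; exact: c0.
have [S0 S0j|noS] := pickP (fun S => k S == j); last first.
  by rewrite !big_pred0 ?mulr0 // => S; rewrite noS ?andbF.
(* All sets of size j have equally many preimages, so this number factors out and leaves the ratio
   defining [prob_without_repl]. *)
have cE S : k S == j -> (c S)%:R = (c S0)%:R :> R.
  move: S0j; rewrite !kE => /eqP S0j /eqP Sj.
  by rewrite /c (@card_fibre_image _ S S0) // Sj S0j.
rewrite (eq_bigr (fun=> (c S0)%:R)) => [|S /andP[_]]; last exact: cE.
rewrite [X in _ * X](eq_bigr (fun=> (c S0)%:R)) //.
have := le_beta j jB; rewrite /prob_without_repl ler_pdivrMr; last first.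
  by rewrite ltr0n bin_gt0 -ltnS.
set N := #|_| => Nle.
have -> : \sum_(S | P S && (k S == j)) (c S0)%:R = N%:R * (c S0)%:R :> R.
  rewrite mulr_natl -[RHS]sumr_const; apply: eq_bigl => S.
  by rewrite inE kE andbC.
have -> : \sum_(S | k S == j) (c S0)%:R = 'C(n, j)%:R * (c S0)%:R :> R.
  have -> : 'C(n, j) = #|[set S : {set 'I_n} | #|S| == j]|.
    by rewrite card_draws card_ord.
  rewrite mulr_natl -[RHS]sumr_const; apply: eq_bigl => S.
  by rewrite inE kE.
by rewrite mulrA ler_wpM2r.
Qed.

End Uniform.

Theorem theorem3 (R : realType) :
  exists (C zeta : R) (N0 : nat), 0 < C /\ 0 < zeta /\
  forall (n : nat) (e : rel 'I_n) (eps : R),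
    (N0 <= n)%N -> symmetric e -> irreflexive e ->
    (0 < maxdeg e)%N -> 0 < eps < 1 ->
    let B := sample_size n (maxdeg e) eps in
    let bad := fun S : {set 'I_n} =>
      C * ln (n%:R) / eps ^+ 2 < (largest_cc e S)%:R in
    prob_with_repl R B bad <= powR (n%:R) (- zeta) /\
    prob_without_repl R B bad <= powR (n%:R) (- zeta).
Proof.
(* With C = 16 the exponential is at most n^-4; the factors n (union bound) and n + 1 (conditioning)
   leave at most 1/n, since n + 1 <= n^2 for n >= 2. *)
exists 16, 1, 2%N; split=> //; split=> // n e eps n2 esym _ D0 eps01 B bad.
have n2R : 2 <= n%:R :> R by rewrite ler_nat.
have nR : 0 < n%:R :> R by lra.
have DR : 0 < (maxdeg e)%:R :> R by rewrite ltr0n.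
have [eps0 eps1] := andP eps01.
have BR : B%:R <= (1 - eps) * n%:R / (maxdeg e)%:R :> R.
  by rewrite truncn_le divr_ge0 // mulr_ge0 //; lra.
have Bn : (B <= n)%N.
  rewrite -(ler_nat R); apply: (le_trans BR); rewrite ler_pdivrMr //.
  rewrite mulrC ler_pM2l //; apply: (@le_trans _ _ 1); first by lra.
  by rewrite ler1n.
have expln : expR (ln n%:R) = n%:R :> R by rewrite lnK.
have ln_ge : 2^-1 <= ln n%:R :> R.
  have := expR_ge1Dx (- ln (n%:R : R)); rewrite expRN expln.
  have : n%:R^-1 <= 2^-1 :> R by rewrite lef_pV2 ?posrE.
  by lra.
pose L : R := 16 * ln n%:R / eps ^+ 2.
have e20 : 0 < eps ^+ 2 by rewrite exprn_gt0.
have e21 : eps ^+ 2 <= 1 by rewrite exprn_ile1 // ltW.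
have L1 : 1 <= L by rewrite ler_pdivlMr // mul1r; lra.
(* All j <= B are treated, because repeated draws may leave fewer than B distinct vertices. *)
have tail j : (j <= B)%N -> prob_without_repl R j bad <= powR n%:R (- 1).
  move=> jB; apply: (le_trans (prob_without_repl_le_weight R bad _ _)); try lia.
  (* This d solves j/n = (1 - d)/D; a smaller sample is only more subcritical, so d >= eps. *)
  pose d : R := 1 - j%:R * (maxdeg e)%:R / n%:R.
  have jR : j%:R <= (1 - eps) * n%:R / (maxdeg e)%:R :> R.
    by apply: le_trans BR; rewrite ler_nat.
  have ed : eps <= d.
    rewrite lerBrDl -lerBrDr ler_pdivrMr //.
    by rewrite -ler_pdivlMr.
  have d01 : 0 <= d <= 1.
    rewrite (le_trans (ltW eps0) ed) /= lerBlDr lerDl.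
    by rewrite divr_ge0 // mulr_ge0.
  have -> : j%:R / n%:R = (1 - d) / (maxdeg e)%:R :> R.
    by rewrite /d; field; rewrite !lt0r_neq0.
  rewrite powRN powRr1 ?ler0n //.
  have expL : expR (- (d ^+ 2 / 4) * L) <= n%:R^-1 ^+ 4.
    rewrite -expln -expRN -expRM_natr ler_expR !mulNr lerN2.
    have -> : d ^+ 2 / 4 * L = ln n%:R * 4 * (d ^+ 2 / eps ^+ 2).
      by rewrite /L; field; rewrite lt0r_neq0.
    rewrite ler_peMr //; first by lra.
    by rewrite ler_pdivlMr // mul1r lerXn2r // nnegrE; lra.
  have /(ler_wpM2l (ler0n R n.+1)) := weight_largest_cc_tail esym D0 d01 L1.
  move/le_trans; apply.
  apply: (@le_trans _ _ (n.+1%:R * (n%:R * n%:R^-1 ^+ 4))).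
    by rewrite !ler_wpM2l.
  have -> : n.+1%:R * (n%:R * n%:R^-1 ^+ 4) = n.+1%:R / n%:R ^+ 2 * n%:R^-1 :> R.
    by field; rewrite lt0r_neq0.
  rewrite ler_piMl ?invr_ge0 ?ler0n // ler_pdivrMr ?exprn_gt0 // mul1r.
  by rewrite -natr1; nra.
split; last exact: tail.
by apply: prob_with_repl_le tail; lia.
Qed.
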